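(* Let $n\ge 2$ and $r\in\{2,3\}$. The graph $P_{n+r}+P_n$ admits a $2$-super graceful labeling whose edge-label set is $[2,2n+r-1]$.
   Context: $P_m$ is the path on $m$ vertices, and $G+H$ denotes the disjoint union of graphs $G$ and $H$. For integers $a\le b$, $[a,b]$ is the set of integers between $a$ and $b$ inclusive. For $k\ge 1$, a $k$-super graceful labeling of a graph $G=(V,E)$ with $p$ vertices and $q$ edges is a bijection $f:V\cup E\to[k,k+p+q-1]$ with $f(uv)=|f(u)-f(v)|$ for every edge $uv$. *)

(* Defs.v *)
From mathcomp Require Import all_boot all_order all_algebra.

Set Implicit Arguments.
Unset Strict Implicit.
Unset Printing Implicit Defensive.

Record sgraph := SGraph {
  vertex :> finType;
  adj : rel vertex;
  adj_sym : symmetric adj;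
  adj_irr : irreflexive adj
}.

(* An edge is the unordered pair of its end points. *)
Definition edges (G : sgraph) : {set {set G}} :=
  [set [set p.1; p.2] | p in [set p : G * G | adj p.1 p.2]].

Definition edge (G : sgraph) : Type := {e : {set G} | e \in edges G}.

Definition path_adj (m : nat) : rel 'I_m :=
  fun i j => (i.+1 == j :> nat) || (j.+1 == i :> nat).

Lemma path_adj_sym (m : nat) : symmetric (@path_adj m).
Proof. by move=> i j; rewrite /path_adj orbC. Qed.

Lemma path_adj_irr (m : nat) : irreflexive (@path_adj m).
Proof. by move=> i; rewrite /path_adj orbb -[X in _ == X]add0n -add1n eqn_add2r. Qed.

Definition path_graph (m : nat) : sgraph :=
  SGraph (@path_adj_sym m) (@path_adj_irr m).

Definition union_adj (G H : sgraph) : rel (G + H)%type :=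
  fun x y => match x, y with
             | inl u, inl v => adj u v
             | inr u, inr v => adj u v
             | _, _ => false
             end.

Lemma union_adj_sym (G H : sgraph) : symmetric (@union_adj G H).
Proof. by move=> [u|u] [v|v] //=; rewrite adj_sym. Qed.

Lemma union_adj_irr (G H : sgraph) : irreflexive (@union_adj G H).
Proof. by move=> [u|u] /=; rewrite adj_irr. Qed.

Definition disjoint_union (G H : sgraph) : sgraph :=
  SGraph (@union_adj_sym G H) (@union_adj_irr G H).

(* A labeling of V u E is a function on the disjoint sum of the two types; it is
   meant for k >= 1, so that the subtraction below is never truncated. *)
Definition super_graceful (k : nat) (G : sgraph) (f : G + edge G -> nat) : Prop :=
  [/\ injective f,
      forall i : nat,
        (exists z : G + edge G, f z = i) <->
        k <= i <= k + #|G| + #|edges G| - 1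
    & forall (u v : G) (e : edge G), val e = [set u; v] ->
        f (inr e) = `|f (inl u) - f (inl v)|%N].

(* Main.v *)
Require Import Defs.
From mathcomp Require Import all_boot all_order all_algebra.
From mathcomp Require Import zify.

(** Put N = 2n + r. It suffices to label the vertices bijectively by [0, N - 1]
    with edge differences [2, N - 1], and then to add N to every vertex label.
    The long path is labeled n+1, 0, N-1, 1, N-2, 2, ...: its first difference
    is n+1 and the others are N-1, N-2, ..., n+2. The labels left over are those
    around n+1; the short path runs through them as n, n+2, n-1, n+3, ..., or
    the mirror image n+2, n, n+3, n-1, ... when r = 3, with differences
    2, 3, ..., n. *)

(** Pigeonhole: subtracting [k] gives an injection into ['I_#|T|], a type of the same size.
    Surjectivity thus always follows from injectivity and range bounds. *)
Lemma injective_interval_onto (T : finType) (f : T -> nat) (k : nat) :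
  injective f -> (forall x, k <= f x < k + #|T|) ->
  forall i, (exists x, f x = i) <-> k <= i < k + #|T|.
Proof.
move=> f_inj f_range i; split=> [[x <-] //|i_range].
have fk_lt x : f x - k < #|T| by have := f_range x; lia.
have ik_lt : i - k < #|T| by lia.
have fk_inj : injective (fun x => Ordinal (fk_lt x)).
  move=> x y /(congr1 val) /= fk_eq; apply: f_inj.
  by have := f_range x; have := f_range y; lia.
have card_le : #|'I_#|T| | <= #|T| by rewrite card_ord.
have /codomP[x /(congr1 val) /= fx] :=
  inj_card_onto fk_inj card_le (Ordinal ik_lt).
by exists x; have := f_range x; lia.
Qed.

Lemma edgesP (G : sgraph) (e : {set G}) :
  reflect (exists u v, adj u v /\ e = [set u; v]) (e \in edges G).
Proof.
apply: (iffP imsetP) => [[[u v]]|[u [v [uv ->]]]].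
  by rewrite inE /= => uv ->; exists u, v.
by exists (u, v); rewrite ?inE.
Qed.

Lemma edges_disjoint_union (G H : sgraph) :
  edges (disjoint_union G H) =
    [set (inl : G -> G + H) @: e | e : {set G} in edges G] :|:
    [set (inr : H -> G + H) @: e | e : {set H} in edges H].
Proof.
apply/setP=> e; rewrite inE; apply/edgesP/orP.
  case=> -[u|u] [[v|v] [//= uv ->]]; [left|right];
    by apply/imsetP; exists [set u; v]; rewrite ?imsetU1 ?imset_set1 //;
       apply/edgesP; exists u, v.
case=> /imsetP[_ /edgesP[u [v [uv ->]]] ->].
  by exists (inl u), (inl v); rewrite imsetU1 imset_set1.
by exists (inr u), (inr v); rewrite imsetU1 imset_set1.
Qed.

Lemma card_edges_disjoint_union (G H : sgraph) :
  #|edges (disjoint_union G H)| = #|edges G| + #|edges H|.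
Proof.
rewrite edges_disjoint_union cardsU.
rewrite (card_imset _ (imset_inj inl_inj)) (card_imset _ (imset_inj inr_inj)).
rewrite (_ : _ :&: _ = set0) ?cards0 ?subn0 //.
apply/setP=> e; rewrite !inE; apply/negP.
(* A common edge would contain [inl u], which is no value of [inr]. *)
case/andP=> /imsetP[_ /edgesP[u [v [_ ->]]] ->] /imsetP[e' _] /setP/(_ (inl u)).
rewrite mem_imset; last exact: inl_inj.
by rewrite set21 => /esym/imsetP[].
Qed.

Lemma path_edgesP (m : nat) (e : {set 'I_m}) :
  reflect (exists i j : 'I_m, i.+1 = j :> nat /\ e = [set i; j])
          (e \in edges (path_graph m)).
Proof.
apply: (iffP (edgesP (path_graph m) e)) => [[i [j [/orP[]/eqP ij ->]]]|[i [j [ij ->]]]].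
- by exists i, j.
- by exists j, i; rewrite setUC.
- by exists i, j; split=> //=; rewrite /path_adj ij eqxx.
Qed.

Lemma card_edges_path (m : nat) : #|edges (path_graph m)| = m.-1.
Proof.
case: m => [|m].
  by apply: eq_card0 => e; apply/negP=> /path_edgesP[[]].
(* Edges are indexed by their smaller end point. *)
pose step (i : 'I_m) : {set 'I_m.+1} := [set widen_ord (leqnSn m) i; lift ord0 i].
have step_inj : injective step.
  move=> i j /setP ij; apply: val_inj => /=.
  have := ij (widen_ord (leqnSn m) i); have := ij (lift ord0 i).
  rewrite !inE -!val_eqE /= /bump /=; lia.
rewrite (_ : edges (path_graph m.+1) = step @: setT) ?card_imset ?cardsT ?card_ord //.
apply/setP=> e; apply/path_edgesP/imsetP=> [[i [j [ij ->]]]|[i _ ->]].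
  have im : i < m by have := ltn_ord j; lia.
  exists (Ordinal im) => //; congr [set _; _]; exact: val_inj.
by exists (widen_ord (leqnSn m) i), (lift ord0 i).
Qed.

(* On a two-element set this is the difference of the two labels. *)
Definition spread (G : finType) (g : G -> nat) (e : {set G}) : nat :=
  \max_(u in e) \max_(v in e) `|g u - g v|%N.

Lemma spread2 (G : finType) (g : G -> nat) (u v : G) :
  spread _ g [set u; v] = `|g u - g v|%N.
Proof.
apply/eqP; rewrite eqn_leq; apply/andP; split; last first.
  by apply: (bigmax_sup u); rewrite ?set21 //; apply: (bigmax_sup v); rewrite ?set22.
apply/bigmax_leqP=> x /set2P[] ->; apply/bigmax_leqP=> y /set2P[] ->; lia.
Qed.

Definition induced_labeling (G : sgraph) (g : G -> nat) (z : G + edge G) : nat :=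
  match z with inl v => g v | inr e => spread _ g (val e) end.

(** Edge labels fill the lower block of length q and vertex labels the block of length p above it.
    The blocks are disjoint, so each can be treated alone, by counting. *)
Lemma induced_labeling_super_graceful (k : nat) (G : sgraph) (g : G -> nat) :
  let p := #|G| in let q := #|edges G| in
  0 < k -> injective g -> (forall v, k + q <= g v < k + q + p) ->
  {in edges G &, injective (spread _ g)} ->
  (forall e, e \in edges G -> k <= spread _ g e < k + q) ->
  super_graceful k (induced_labeling G g) /\
  (forall i, (exists e, induced_labeling G g (inr e) = i) <-> k <= i < k + q).
Proof.
move=> p q k_gt0 g_inj g_range d_inj d_range.
pose d (e : {e : {set G} | e \in edges G}) := spread _ g (val e).
have card_edge : #|{: {e : {set G} | e \in edges G}}| = q by rewrite card_sig.
have edge_onto i : (exists e, d e = i) <-> k <= i < k + q.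
  rewrite -card_edge; apply: injective_interval_onto => [e e' ee'|e].
    by apply: val_inj; apply: d_inj => //; apply: valP.
  by rewrite card_edge; apply/d_range/valP.
have vertex_onto i : (exists v, g v = i) <-> k + q <= i < k + q + p.
  exact: injective_interval_onto.
have edge_range (e : edge G) : k <= induced_labeling G g (inr e) < k + q.
  exact: d_range (valP e).
split=> //; split.
- move=> [u|e] [v|e'] /= eq_l.
  + by rewrite (g_inj _ _ eq_l).
  + by have := g_range u; have := edge_range e'; rewrite /= -eq_l; lia.
  + by have := g_range v; have := edge_range e; rewrite /= eq_l; lia.
  + by congr inr; apply: val_inj; apply: d_inj => //; apply: valP.
(* As k > 0, the -1 is not truncated, and the interval is the union of the two blocks. *)
- move=> i; rewrite -[X in _ <-> _ <= _ <= X]/(k + p + q - 1).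
  split=> [[[v|e] <-]|i_range].
  + by have := g_range v; rewrite /=; lia.
  + by have := edge_range e; lia.
  have [i_lt|i_ge] := ltnP i (k + q).
    have [|e <-] := (edge_onto i).2; first lia.
    by exists (inr e).
  have [|v <-] := (vertex_onto i).2; first lia.
  by exists (inl v).
- by move=> u v e /= ->; rewrite spread2.
Qed.

(** At position 0 the even formula would give N, just out of range; n+1 replaces it. *)
Definition long_label (n r i : nat) : nat :=
  if i == 0 then n + 1 else if odd i then i./2 else 2 * n + r - i./2.

(** The long path leaves ceil(n/2) labels below n+1 if r = 2, but above n+1 if r = 3. The even
    positions, ceil(n/2) in number, must go to that side, hence the reflection about n+1. *)
Definition short_label (n r j : nat) : nat :=
  let x := if odd j then n + 2 + j./2 else n - j./2 in
  if r == 2 then x else 2 * n + 2 - x.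

Lemma long_label_step (n r i : nat) :
  i.+1 < n + r ->
  `|long_label n r i - long_label n r i.+1|%N =
    if i == 0 then n + 1 else 2 * n + r - i.
Proof. by rewrite /long_label; do ?case: ifP; lia. Qed.

Lemma short_label_step (n r j : nat) :
  j.+1 < n -> `|short_label n r j - short_label n r j.+1|%N = j + 2.
Proof. by rewrite /short_label; do ?case: ifP; lia. Qed.

Lemma long_label_lt (n r i : nat) :
  1 < r -> i < n + r -> long_label n r i < 2 * n + r.
Proof. by rewrite /long_label; do ?case: ifP; lia. Qed.

Lemma short_label_lt (n r j : nat) :
  r = 2 \/ r = 3 -> j < n -> short_label n r j < 2 * n + r.
Proof. by rewrite /short_label; do ?case: ifP; lia. Qed.

(** Odd positions climb from 0 and later even ones descend from N-1; the path ends before either run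
    reaches n+1. *)
Lemma long_label_inj (n r i j : nat) :
  r = 2 \/ r = 3 -> i < n + r -> j < n + r ->
  long_label n r i = long_label n r j -> i = j.
Proof.
by rewrite /long_label; do ?case: ifP; lia.
Qed.

Lemma short_label_inj (n r i j : nat) :
  i < n -> j < n -> short_label n r i = short_label n r j -> i = j.
Proof. by rewrite /short_label; do ?case: ifP; lia. Qed.

(** Apart from n+1, which the short path skips, the long path uses an initial and a final segment of
    [0, N-1]; the short labels lie strictly between these. *)
Lemma long_short_label_neq (n r i j : nat) :
  r = 2 \/ r = 3 -> i < n + r -> j < n ->
  long_label n r i <> short_label n r j.
Proof.
by rewrite /long_label /short_label; do ?case: ifP; lia.
Qed.

Definition two_path_label (n r : nat)
    (z : disjoint_union (path_graph (n + r)) (path_graph n)) : nat :=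
  2 * n + r + match z with
              | inl i => long_label n r (i : 'I_(n + r))
              | inr j => short_label n r (j : 'I_n)
              end.

(** The shift by N cancels, and the smaller position on an edge determines its label. *)
Lemma two_path_spread (n r : nat) (e : {set 'I_(n + r) + 'I_n}) :
  e \in edges (disjoint_union (path_graph (n + r)) (path_graph n)) ->
  (exists i i' : 'I_(n + r), [/\ i.+1 = i' :> nat, e = [set inl i; inl i'] &
     spread _ (two_path_label n r) e =
       if i == 0 :> nat then n + 1 else 2 * n + r - i]) \/
  (exists j j' : 'I_n, [/\ j.+1 = j' :> nat, e = [set inr j; inr j'] &
     spread _ (two_path_label n r) e = j + 2]).
Proof.
rewrite edges_disjoint_union inE.
case/orP=> /imsetP[_ /path_edgesP[i [j [ij ->]]] ->]; [left|right];
  exists i, j; rewrite imsetU1 imset_set1 spread2; split=> //.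
- by rewrite distnDl -ij long_label_step // ij ltn_ord.
- by rewrite distnDl -ij short_label_step // ij ltn_ord.
Qed.

Theorem theorem4p12 (n r : nat) (hn : 2 <= n) (hr : r = 2 \/ r = 3) :
  let G := disjoint_union (path_graph (n + r)) (path_graph n) in
  exists f : G + edge G -> nat,
    super_graceful 2 f /\
    (forall i : nat,
       (exists e : edge G, f (inr e) = i) <-> 2 <= i <= 2 * n + r - 1).
Proof.
move=> G; exists (induced_labeling G (two_path_label n r)).
have r_gt1 : 1 < r by lia.
have card_V : #|G| = 2 * n + r by rewrite card_sum !card_ord; lia.
(* With q = N-2 and k = 2 the vertex block starts at N, which is the shift in [two_path_label]. *)
have card_E : #|edges G| = 2 * n + r - 2.
  by rewrite card_edges_disjoint_union !card_edges_path; lia.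
have [|||||sg edge_onto] :=
    induced_labeling_super_graceful 2 G (two_path_label n r); last first.
- split=> // i; split=> [/edge_onto|i_range]; first by rewrite card_E; lia.
  by apply/edge_onto; rewrite card_E; lia.
- move=> e /two_path_spread[] [i [j [ij _ ->]]];
    have := ltn_ord j; rewrite card_E; do ?case: ifP; lia.
- move=> e e' /two_path_spread He /two_path_spread He'.
  case: He He' => -[i [j [ij -> ->]]] [] [i' [j' [ij' -> ->]]];
    have := ltn_ord j'; have := ltn_ord j => jm jm' eq_d.
  (* For i > 0 the bound on j gives N-i >= n+2, so n+1 occurs only at i = 0. *)
  + have ii' : i = i' by apply: val_inj; move: eq_d; do ?case: ifP => /=; lia.
    by rewrite ii' (_ : j = j') //; apply: val_inj; rewrite /= -ij -ij' ii'.
  (* Long-path differences are at least n+1, short-path ones at most n. *)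
  + by exfalso; move: eq_d; case: ifP; lia.
  + by exfalso; move: eq_d; case: ifP; lia.
  + have ii' : i = i' by apply: val_inj => /=; lia.
    by rewrite ii' (_ : j = j') //; apply: val_inj; rewrite /= -ij -ij' ii'.
- rewrite card_V card_E => -[i|i]; rewrite /two_path_label.
    by have := long_label_lt n r i r_gt1 (ltn_ord i); lia.
  by have := short_label_lt n r i hr (ltn_ord i); lia.
- move=> [i|i] [j|j] /addnI eq_l.
  + congr inl; apply: val_inj; exact: long_label_inj eq_l.
  + by case: (@long_short_label_neq n r i j).
  + by case: (@long_short_label_neq n r j i).
  + congr inr; apply: val_inj; exact: short_label_inj eq_l.
- by [].
Qed.
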